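(* Let $r,s\ge 2$ and $n\ge 0$ be integers, $q\ge2$ a prime power, and $$\eta_{r,n,s}(q)=q^{\binom{r+n-s}{r}+r-1}\,\frac{(1-q^{-r})\bigl(1-q^{-\binom{r+n-s-1}{r-1}}\bigr)}{(1-q^{-1})^2},\qquad \delta=\binom{r+n-s}{r}-\binom{r+n-2s}{r}-\frac{r(r+1)}{2}.$$ (i) For $(n,s)=(6,2)$, we have $\delta=r(r+1)(r^2+9r+2)/24$ and $$\bigl|\#Q_{r,6,2}(\mathbb{F}_q)-\eta_{r,6,2}(q)\bigr|\le\eta_{r,6,2}(q)\cdot 2\,q^{-\delta+(r-2)(r-1)(r+3)/6}.$$ (ii) For $n\ge 3s$ and $(n,s)\ne(6,2)$, we have $$\bigl|\#Q_{r,n,s}(\mathbb{F}_q)-\eta_{r,n,s}(q)\bigr|\le\eta_{r,n,s}(q)\cdot 6\,q^{-\delta}.$$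
   Context: $\mathbb{F}_q$ is the finite field with $q$ elements. Fix a monomial order (say degree-lexicographic) on $\mathbb{F}_q[x_1,\dots,x_r]$; a polynomial is monic if its leading coefficient is $1$. $P_{r,n}(\mathbb{F}_q)$ is the set of monic polynomials in $\mathbb{F}_q[x_1,\dots,x_r]$ of total degree exactly $n$. A polynomial is $s$-powerful if it is divisible by the $s$th power of some nonconstant polynomial; $Q_{r,n,s}(\mathbb{F}_q)$ is the set of $s$-powerful polynomials in $P_{r,n}(\mathbb{F}_q)$. *)

(* Defs.v *)
From HB Require Import structures.
From mathcomp Require Import all_boot all_order all_algebra.
From mathcomp Require Import finmap mpoly.
From mathcomp Require Import boolp classical_sets functions cardinality.

Set Implicit Arguments.
Unset Strict Implicit.
Unset Printing Implicit Defensive.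

Import Order.TTheory GRing.Theory Num.Theory.

Local Open Scope classical_set_scope.
Local Open Scope ring_scope.

(* [mleadc] is taken with respect to the order [mnmc_le] on monomials, which
   compares (mdeg m1 :: m1) with (mdeg m2 :: m2) lexicographically: this is the
   degree-lexicographic order.  [msize f] is 1 + the total degree of [f], with
   [msize 0 = 0], so [msize f = n.+1] says that [f] has degree exactly [n]. *)
Definition monic_deg (F : finFieldType) (r n : nat) : set {mpoly F[r]} :=
  [set f | mleadc f = 1 /\ msize f = n.+1].

Definition powerful (F : finFieldType) (r s : nat) (f : {mpoly F[r]}) : Prop :=
  exists g : {mpoly F[r]},
    ~ (exists c : F, g = c%:MP) /\ (exists h : {mpoly F[r]}, f = h * g ^+ s).

Definition powerful_monic_deg (F : finFieldType) (r n s : nat) :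
    set {mpoly F[r]} :=
  [set f | monic_deg n f /\ powerful s f].

Lemma finite_monic_deg (F : finFieldType) (r n : nat) :
  finite_set (@monic_deg F r n).
Proof.
pose poly_of (c : {ffun 'X_{1..r < n.+1} -> F}) : {mpoly F[r]} :=
  \sum_(m : 'X_{1..r < n.+1}) c m *: 'X_[m].
apply: (@sub_finite_set _ _ (poly_of @` setT)); last exact/finite_image.
move=> f [_ sf]; exists [ffun m : 'X_{1..r < n.+1} => f@_m] => //.
rewrite /poly_of [RHS](mpolywE (k := n.+1)) ?sf //.
by apply: eq_bigr => m _; rewrite ffunE.
Qed.

(* Guarantees that the [fset_set] below is not the junk value [fset0]. *)
Lemma finite_powerful_monic_deg (F : finFieldType) (r n s : nat) :
  finite_set (@powerful_monic_deg F r n s).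
Proof. by apply: sub_finite_set (@finite_monic_deg F r n) => f []. Qed.

Definition num_powerful (F : finFieldType) (r n s : nat) : nat :=
  #|` fset_set (@powerful_monic_deg F r n s)|.

(* The natural-number subtractions below are exact as soon as
   [1 <= r], [1 <= s] and [2 * s <= n]. *)
Definition eta (r n s q : nat) : rat :=
  q%:R ^+ ('C(r + n - s, r) + r - 1) *
    ((1 - q%:R ^- r) * (1 - q%:R ^- 'C(r + n - s - 1, r - 1))
      / (1 - q%:R^-1) ^+ 2).

(* The division by 2 is exact. *)
Definition delta (r n s : nat) : int :=
  'C(r + n - s, r)%:Z - 'C(r + n - 2 * s, r)%:Z - ((r * (r + 1)) %/ 2)%N%:Z.

(* Main.v *)
(* Write [P k] for the number of monic polynomials of degree [k].  Then [eta] is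
   exactly [P 1 * P (n - s)], the number of pairs of a monic linear [l] and a
   monic [h] of degree [n - s].  Every [s]-powerful polynomial has the form
   [h * g ^+ s] with [g] monic of some degree [k >= 1], which gives the upper
   bound [\sum_k P k * P (n - s * k)].  For the lower bound only [k = 1] is used:
   the polynomials divisible by both [l ^+ s] and [l' ^+ s] are overcounted, and
   since linear polynomials are prime there are at most [P (n - 2 * s)] of them.
   Up to bounded factors the term of index [k] is a power of [q] with exponent
   ['C(r + k, r) + 'C(r + n - s * k, r) - 2].  Convexity of [k |-> 'C(r + k, r)]
   makes [k = 2] dominate the sum over [k >= 2] with geometric decay, except for
   [(n, s) = (6, 2)], where [k = 3] may dominate. *)

Require Import Defs.
From mathcomp Require Import all_boot all_order all_algebra.
From mathcomp Require Import finmap mpoly ring lra zify.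
From mathcomp Require Import boolp classical_sets functions cardinality.

Set Implicit Arguments.
Unset Strict Implicit.
Unset Printing Implicit Defensive.

Import Order.TTheory GRing.Theory Num.Theory.

Local Open Scope ring_scope.

(** * Divisibility among monic polynomials; linear ones are prime *)

Section MonicPolynomials.

Variables (F : finFieldType) (r : nat).
Implicit Types (f g h l p : {mpoly F[r]}) (m n : nat).

Local Notation monic_deg := (@monic_deg F r).

Lemma monic_deg_neq0 n f : monic_deg n f -> f != 0.
Proof. by case=> _ sf; rewrite -msize_poly_eq0 sf. Qed.

Lemma mleadc_mul f g : mleadc (f * g) = mleadc f * mleadc g.
Proof.
have [->|f0] := eqVneq f 0; first by rewrite mul0r mleadc0 mul0r.
have [->|g0] := eqVneq g 0; first by rewrite mulr0 mleadc0 mulr0.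
by rewrite mleadcM_proper // mulf_neq0 // mleadc_eq0.
Qed.

Lemma monic_deg0 : monic_deg 0 1.
Proof. by split; rewrite ?mleadc1 ?msize1. Qed.

Lemma monic_degM m n f g :
  monic_deg m f -> monic_deg n g -> monic_deg (m + n)%N (f * g).
Proof.
move=> Hf Hg; have f0 := monic_deg_neq0 Hf; have g0 := monic_deg_neq0 Hg.
case: Hf Hg => lf sf [lg sg].
by split; rewrite ?mleadc_mul ?lf ?lg ?mulr1 // msizeM // sf sg addnS.
Qed.

Lemma monic_degX n k f : monic_deg n f -> monic_deg (k * n)%N (f ^+ k).
Proof.
move=> Hf; elim: k => [|k IH]; first exact: monic_deg0.
by rewrite exprS mulSn; apply: monic_degM.
Qed.

Lemma monic_deg_divl m n g h : monic_deg m g -> monic_deg n (h * g) ->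
  (m <= n)%N /\ monic_deg (n - m) h.
Proof.
move=> Hg Hhg; have g0 := monic_deg_neq0 Hg.
have h0 : h != 0 by apply: contraNneq (monic_deg_neq0 Hhg) => ->; rewrite mul0r.
case: Hg Hhg => lg sg []; rewrite mleadc_mul lg mulr1 => lh.
have: msize h != 0%N by rewrite msize_poly_eq0.
rewrite msizeM // sg; case E: (msize h) => [|a] // _; rewrite addnS /= => - [<-].
by rewrite leq_addl addnK.
Qed.

(** Congruence modulo [l] respects sums and products, so replacing each variable by a congruent
    value changes [p] only by a multiple of [l]. The induction runs over the monomials of [p]. *)
Lemma comp_mpoly_congr l (t : r.-tuple {mpoly F[r]}) :
  (forall i, exists h, 'X_i - tnth t i = l * h) ->
  forall p, exists h, p - (p \mPo t) = l * h.
Proof.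
move=> Ht.
have HM p1 p2 q1 q2 : (exists h, p1 - q1 = l * h) ->
    (exists h, p2 - q2 = l * h) -> exists h, p1 * p2 - q1 * q2 = l * h.
  move=> [h1 E1] [h2 E2]; exists (p1 * h2 + h1 * q2).
  have -> : p1 * p2 - q1 * q2 = p1 * (p2 - q2) + (p1 - q1) * q2 by ring.
  by rewrite E1 E2; ring.
have H1 : exists h, 1 - 1 = l * h by exists 0; rewrite subrr mulr0.
elim/mpolyind => [|c mm p _ _ [h IH]].
  by exists 0; rewrite comp_mpoly0 subrr mulr0.
suff [h' E] : exists h', 'X_[mm] - ('X_[mm] \mPo t) = l * h'.
  exists (c *: h' + h); rewrite comp_mpolyD comp_mpolyZ mulrDr -IH -scalerAr -E.
  by rewrite scalerBr; ring.
rewrite comp_mpolyX mpolyXE_id.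
apply: (big_ind2 (fun a b : {mpoly F[r]} => exists h, a - b = l * h)) 
  => [|p1 q1 p2 q2|i _] //; first exact: HM.
by elim: (mm i) => // k IHk; rewrite !exprS; apply: HM.
Qed.

Lemma msize2E p : (msize p <= 2)%N ->
  p = (p@_0%MM)%:MP + \sum_i p@_U_(i) *: 'X_i.
Proof.
move=> sp; apply/mpolyP => m; rewrite mcoeffD mcoeffC raddf_sum /=.
under eq_bigr do rewrite mcoeffZ mcoeffX.
have [->|m0] := eqVneq m 0%MM.
  rewrite mulr1 big1 ?addr0 // => i _.
  by rewrite mnm1_eq0 mulr0.
rewrite mulr0 add0r.
have [/mdeg1P [i /eqP ->]|m1] := boolP (mdeg m == 1%N).
  rewrite (bigD1 i) //= eqxx mulr1 big1 ?addr0 // => j ji.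
  by rewrite eq_mnm1 (negPf ji) mulr0.
rewrite big1 => [|i _]; last first.
  by have [E|_] := eqVneq U_(i)%MM m; [move: m1; rewrite -E mdeg1 | rewrite mulr0].
apply: memN_msupp_eq0; apply: msize_mdeg_ge; apply: leq_trans sp _.
by move: m0 m1; rewrite -mdeg_eq0; case: (mdeg m) => [|[]].
Qed.

Lemma monic_deg1_coef l : monic_deg 1 l -> exists i, l@_U_(i) != 0.
Proof.
move=> Hl; have l0 := monic_deg_neq0 Hl; case: (Hl) => _ sl.
have : mdeg (mlead l) == 1%N by rewrite -eqSS mlead_deg // sl.
case/mdeg1P=> i /eqP E; exists i.
by rewrite -E mleadc_eq0.
Qed.

(* Substituting for one variable the value that makes [l] vanish is a ring
   morphism with kernel the ideal of [l]. *)
Lemma monic_deg1_prime l : monic_deg 1 l -> forall f g,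
  (exists h, f * g = l * h) -> (exists h, f = l * h) \/ (exists h, g = l * h).
Proof.
move=> Hl; have [i ci] := monic_deg1_coef Hl; case: Hl => _ sl.
pose t := [tuple ('X_j - (if j == i then (l@_U_(i))^-1 *: l else 0)
  : {mpoly F[r]}) | j < r].
(* As [l] is affine, shifting ['X_i] by [c^-1 *: l], with [c] its coefficient in [l], changes [l] by
   exactly [- l]. *)
have tl : l \mPo t = 0.
  rewrite {1}(@msize2E l) ?sl // comp_mpolyD comp_mpolyC raddf_sum /=.
  under eq_bigr do rewrite comp_mpolyZ comp_mpolyXU -tnth_nth tnth_mktuple scalerBr.
  rewrite sumrB addrA -(@msize2E l) ?sl //.
  rewrite (bigD1 i) //= eqxx scalerA divff // scale1r big1 ?addr0 ?subrr //.
  by move=> j /negPf ->; rewrite scaler0.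
have Ht j : exists h, 'X_j - tnth t j = l * h.
  rewrite tnth_mktuple; case: ifP => _.
    by exists (l@_U_(i))^-1%:MP; rewrite opprB addrCA subrr addr0 mulrC mul_mpolyC.
  by exists 0; rewrite subr0 subrr mulr0.
have ker p : p \mPo t = 0 -> exists h, p = l * h.
  by move=> p0; have [h E] := comp_mpoly_congr Ht p; exists h; rewrite -E p0 subr0.
move=> f g [h /(congr1 (comp_mpoly t))/eqP].
rewrite !rmorphM /= tl mul0r mulf_eq0 => /orP[] /eqP; first by left; apply: ker.
by right; apply: ker.
Qed.

(** Primeness brings the divisibility down to [l] dividing [l']; the degrees agree, so the cofactor
    is a monic constant, that is [1]. *)
Lemma monic_deg1_dvdX l l' s : monic_deg 1 l -> monic_deg 1 l' ->
  (exists h, l' ^+ s = l * h) -> l = l'.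
Proof.
move=> Hl Hl'; elim: s => [|s IH] [h]; rewrite ?exprS ?expr0.
  (* For [s = 0], [l] would divide [1], which the degrees forbid. *)
  by move: monic_deg0; move=> /[swap] ->; rewrite mulrC; case/(monic_deg_divl Hl).
move=> E; case: (monic_deg1_prime Hl (ex_intro _ h E)) => [[h' E']|]; last exact: IH.
have: monic_deg 1 (h' * l) by rewrite mulrC -E'.
case/(monic_deg_divl Hl) => _; rewrite subnn => -[lh sh].
move: E'; have/msize1_polyC Eh : (msize h' <= 1)%N by rewrite sh.
by move: lh; rewrite Eh mleadcC => ->; rewrite mulr1.
Qed.

(** Factors of [l] are moved one at a time into the cofactor [h'] of [l' ^+ s]: each divides
    [g * l' ^+ s], and by primeness it divides [g], as it cannot divide a power of [l']. Unique
    factorization is thereby avoided. *)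
Lemma monic_deg1_coprime l l' s f : monic_deg 1 l -> monic_deg 1 l' -> l != l' ->
  (exists h, f = h * l ^+ s) -> (exists h, f = h * l' ^+ s) ->
  exists h, f = h * (l ^+ s * l' ^+ s).
Proof.
move=> Hl Hl' ne [h Eh] [h' Eh'].
suff H k : (k <= s)%N -> exists g, h' = g * l ^+ k.
  by have [g Eg] := H s (leqnn s); exists g; rewrite Eh' Eg mulrA.
elim: k => [|k IH] ks; first by exists h'; rewrite expr0 mulr1.
have [g Eg] := IH (ltnW ks).
have lk0 : l ^+ k != 0 by rewrite expf_neq0 // (monic_deg_neq0 Hl).
have E : g * l' ^+ s = l * (h * l ^+ (s - k.+1)).
  apply: (mulIf lk0); move: Eh; rewrite Eh' Eg mulrAC => ->.
  by rewrite -[in LHS](subnK ks) exprD exprS; ring.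
case: (monic_deg1_prime Hl (ex_intro _ _ E)) => [[g' Eg']|/(monic_deg1_dvdX Hl Hl')/eqP].
  by exists g'; rewrite Eg Eg' exprS; ring.
by rewrite (negPf ne).
Qed.
End MonicPolynomials.

(** * Counting monomials and monic polynomials *)

Lemma card_bmultinom (r n : nat) : #|{: 'X_{1..r < n.+1}}| = 'C(r + n, r).
Proof.
(* The known count is that of [r]-tuples over ['I_n.+1] with sum at most [n]; exponent vectors of
   monomials of degree at most [n] are exactly these. *)
rewrite -card_partial_ord_partitions.
pose f (m : 'X_{1..r < n.+1}) : r.-tuple 'I_n.+1 := [tuple inord (m i) | i < r].
have le (m : 'X_{1..r < n.+1}) i : (m i < n.+1)%N.
  by apply: leq_ltn_trans (bmdeg m); rewrite mdegE (bigD1 i) //= leq_addr.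
have f_inj : injective f.
  move=> m m' E; apply/val_inj/mnmP => i /=.
  move/(congr1 (fun t => val (tnth t i))): E.
  by rewrite !tnth_mktuple /= !inordK.
rewrite -cardsT -(card_imset _ f_inj); apply/eq_card => t; rewrite inE.
apply/imsetP/idP => [[m _ ->]|].
  rewrite big_tuple -ltnS; apply: leq_ltn_trans (bmdeg m); rewrite mdegE.
  by apply: leq_sum => i _; rewrite tnth_mktuple inordK.
rewrite big_tuple => st.
have Hm : (mdeg [multinom (tnth t i : nat) | i < r] < n.+1)%N.
  by rewrite ltnS mdegE; apply: leq_trans st; apply: leq_sum => i _; rewrite mnmE.
exists (BMultinom Hm) => //; apply/eq_from_tnth => i.
by rewrite tnth_mktuple /= mnmE inord_val.
Qed.

Definition num_monic (F : finFieldType) (r n : nat) : nat :=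
  #|` fset_set (@monic_deg F r n)|.

Section Counting.

Variables (F : finFieldType) (r : nat).
Implicit Types (f g h l p : {mpoly F[r]}) (m n : nat).

Local Notation monics n := (fset_set (@monic_deg F r n)).

Lemma mem_monics n p : (p \in monics n) = `[< monic_deg n p >].
Proof. by rewrite in_fset_set ?inE //; exact: finite_monic_deg. Qed.

(** A polynomial of degree at most [n] either has all its monomials of degree below [n], or is in a
    unique way a nonzero scalar times a monic polynomial of degree [n]. *)
Lemma num_monic_recr n :
  (#|F|.-1 * num_monic F r n + #|F| ^ #|{: 'X_{1..r < n}}|
    = #|F| ^ #|{: 'X_{1..r < n.+1}}|)%N.
Proof.
pose poly_of k (c : {ffun 'X_{1..r < k} -> F}) : {mpoly F[r]} :=
  \sum_m c m *: 'X_[m].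
have poly_inj k : injective (@poly_of k).
  have coefE (c : {ffun 'X_{1..r < k} -> F}) (m : 'X_{1..r < k}) :
      (poly_of k c)@_m = c m.
    rewrite raddf_sum (bigD1 m) //= mcoeffZ mcoeffX eqxx mulr1.
    rewrite big1 ?addr0 // => m' /negPf ne.
    by rewrite mcoeffZ mcoeffX -bmeqP ne mulr0.
  by move=> c c' E; apply/ffunP => m; rewrite -!coefE E.
pose polys k := [seq poly_of k c | c : {ffun 'X_{1..r < k} -> F}].
have size_polys k : size (polys k) = (#|F| ^ #|{: 'X_{1..r < k}}|)%N.
  by rewrite size_map -cardE card_ffun.
have uniq_polys k : uniq (polys k) by rewrite (map_inj_uniq (@poly_inj k)) enum_uniq.
have mem_polys k p : (p \in polys k) = (msize p <= k)%N.
  apply/mapP/idP => [[c _ ->]|sp].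
    apply: leq_trans (msize_sum _ _ _) _; apply/bigmax_leqP => m _.
    by apply: leq_trans (msizeZ_le _ _) _; rewrite msizeX bmdeg.
  exists [ffun m : 'X_{1..r < k} => p@_m]; first by rewrite mem_enum.
  by rewrite /poly_of {1}(mpolywE sp); apply: eq_bigr => m _; rewrite ffunE.
(* [S] lists the polynomials of degree exactly [n]; the leading coefficient recovers the scalar, so
   nothing is repeated. *)
pose S := [seq c *: p | c <- enum (predC1 (0 : F)), p <- enum_fset (monics n)].
have sizeS : size S = (#|F|.-1 * num_monic F r n)%N.
  by rewrite size_allpairs -cardE cardC1.
have uniqS : uniq S.
  apply: allpairs_uniq; rewrite ?enum_uniq ?fset_uniq //.
  move=> [c p] [c' p'] /allpairsP [[c1 p1] /= [_ + [-> ->]]].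
  rewrite mem_monics => /asboolP [lp _] /allpairsP [[c2 p2] /= [c20 + [-> ->]]].
  rewrite mem_monics => /asboolP [lp' _] E.
  have c12 : c1 = c2.
    have := congr1 (fun x : {mpoly F[r]} => mleadc x) E.
    by rewrite /= !mleadcZE lp lp' !mulr1.
  move: c20 E; rewrite mem_enum inE c12 => c20.
  by move/(congr1 (fun x => c2^-1 *: x)); rewrite !scalerA !mulVf // !scale1r => ->.
have memS p : (p \in S) = (msize p == n.+1).
  apply/allpairsP/eqP => [[[c p'] /= [+ + ->]]|sp].
    by rewrite mem_enum mem_monics inE => c0 /asboolP [_ ?]; rewrite msizeZ.
  have lp : mleadc p != 0 by rewrite mleadc_eq0 -msize_poly_eq0 sp.
  exists (mleadc p, (mleadc p)^-1 *: p); split => /=.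
  - by rewrite mem_enum inE.
  - by rewrite mem_monics; apply/asboolP; split;
      rewrite ?mleadcZE ?mulVf // msizeZ // invr_eq0.
  - by rewrite scalerA divff // scale1r.
rewrite -sizeS -!size_polys -size_cat; apply: perm_size; apply: uniq_perm => //.
  rewrite cat_uniq uniqS uniq_polys andbT /=; apply/hasPn => p.
  by rewrite mem_polys memS; apply: contraL => /eqP ->; rewrite ltnn.
by move=> p; rewrite mem_cat memS !mem_polys [RHS]leq_eqVlt.
Qed.

End Counting.

(** * Counting powerful polynomials from above and below *)

Lemma sum_nat_pred (T : Type) (s : seq T) (p : pred T) :
  (\sum_(x <- s) p x)%N = count p s.
Proof. by rewrite -sum1_count [RHS]big_mkcond; apply: eq_bigr => x _; case: p. Qed.

(** This is [m <= 1 + m * (m - 1)] for the number [m] of elements satisfying [p]: once one such [x]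
    is fixed, every other one forms a pair with it. *)
Lemma sum_le_1_pairs (T : eqType) (s : seq T) (p : pred T) : uniq s ->
  (\sum_(x <- s) p x <= 1 + \sum_(x <- s) \sum_(y <- s | y != x) p x * p y)%N.
Proof.
move=> us; have [/hasP [x xs px]|/hasPn np] := boolP (has p s); last first.
  by rewrite big1_seq // => x /andP[_ /np /negPf ->].
rewrite (bigD1_seq x) //= px leq_add2l (bigD1_seq x) //= px.
by under [X in (_ <= X + _)%N]eq_bigr do rewrite mul1n; exact: leq_addr.
Qed.

Section Bounds.

Variables (F : finFieldType) (r : nat).
Implicit Types (f g h l p : {mpoly F[r]}) (m n k s : nat).

Local Notation monics n := (fset_set (@monic_deg F r n)).

Lemma mem_powerfuls n s p : (p \in fset_set (@powerful_monic_deg F r n s)) =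
  `[< monic_deg n p /\ powerful s p >].
Proof. by rewrite in_fset_set ?inE //; exact: finite_powerful_monic_deg. Qed.

(** The factor [g] is divided by its leading coefficient, whose [s]th power is absorbed into [h]. *)
Lemma powerful_decomp n s f : (0 < s)%N -> monic_deg n f -> powerful s f ->
  exists k g h, [/\ (0 < k)%N, (s * k <= n)%N, monic_deg k g,
    monic_deg (n - s * k) h & f = h * g ^+ s].
Proof.
move=> s0 Hf [g [gc [h E]]].
have g0 : g != 0.
  apply: contraNneq (monic_deg_neq0 Hf) => g0.
  by rewrite E g0 expr0n gtn_eqF // mulr0.
have lg : mleadc g != 0 by rewrite mleadc_eq0.
have sg : (1 < msize g)%N.
  by rewrite ltnNge; apply/negP => /msize1_polyC Eg; apply: gc; exists g@_0%MM.
pose g' := (mleadc g)^-1 *: g.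
have Hg' : monic_deg (msize g).-1 g'.
  split; first by rewrite mleadcZE mulVf.
  by rewrite msizeZ ?invr_eq0 // prednK // ltnW.
have E' : f = (mleadc g ^+ s *: h) * g' ^+ s.
  by rewrite exprZn -scalerAl -scalerAr scalerA -exprMn divff // expr1n scale1r.
have [le Hh] := monic_deg_divl (monic_degX s Hg') (eq_ind _ (monic_deg n) Hf _ E').
exists (msize g).-1, g', (mleadc g ^+ s *: h).
by split; rewrite // -ltnS prednK // ltnW.
Qed.

(** Decompositions need not be unique, so the list [L] of all products may repeat entries; only its
    length matters for an upper bound. *)
Lemma num_powerful_le n s : (0 < s)%N ->
  (num_powerful F r n s <=
    \sum_(1 <= k < (n %/ s).+1) num_monic F r k * num_monic F r (n - s * k))%N.
Proof.
move=> s0; pose L := flatten [seq [seq h * g ^+ s | g <- enum_fset (monics k),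
  h <- enum_fset (monics (n - s * k))] | k <- index_iota 1 (n %/ s).+1].
have -> : (\sum_(1 <= k < (n %/ s).+1) num_monic F r k * num_monic F r (n - s * k))%N
    = size L.
  rewrite size_flatten sumnE !big_map; apply: eq_bigr => k _.
  by rewrite size_allpairs.
apply: uniq_leq_size; first exact: fset_uniq.
move=> f; rewrite mem_powerfuls => /asboolP [Hf Pf].
have [k [g [h [k0 le Hg Hh ->]]]] := powerful_decomp s0 Hf Pf.
apply/flattenP; exists [seq h * g ^+ s | g <- enum_fset (monics k),
  h <- enum_fset (monics (n - s * k))].
  by apply: map_f; rewrite mem_index_iota k0 ltnS leq_divRL // mulnC.
by apply: (allpairs_f (fun g h => h * g ^+ s)); rewrite mem_monics; apply/asboolP.
Qed.

Lemma monic_deg1_powerful l s p : monic_deg 1 l -> powerful s (p * l ^+ s).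
Proof.
move=> Hl; exists l; split; last by exists p.
by case=> c Ec; case: Hl => _; rewrite Ec msizeC; case: (c != 0).
Qed.

(** Double counting of the pairs [(l, f)] with [l] monic linear and [l ^+ s] dividing [f]. Each [l]
    lies in at least [num_monic F r (n - s)] pairs, while each [f] is charged [1] plus the number of
    ordered pairs of distinct [l], [l'] whose [s]th powers both divide it. *)
Lemma num_powerful_ge n s : (2 * s <= n)%N ->
  (num_monic F r 1 * num_monic F r (n - s) <=
    num_powerful F r n s
      + num_monic F r 1 * num_monic F r 1 * num_monic F r (n - 2 * s))%N.
Proof.
move=> sn; have sn' : (s <= n)%N by lia.
pose Q := fset_set (@powerful_monic_deg F r n s).
pose d l f := `[< exists h, f = h * l ^+ s >].
pose L := enum_fset (monics 1).
have memL l : (l \in L) = `[< monic_deg 1 l >] by rewrite mem_monics.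
have lb l : l \in L -> (num_monic F r (n - s) <= \sum_(f <- Q) d l f)%N.
  rewrite memL => /asboolP Hl.
  have ls0 : l ^+ s != 0 by rewrite expf_neq0 // (monic_deg_neq0 Hl).
  have -> : num_monic F r (n - s) = 
      size [seq h * l ^+ s | h <- enum_fset (monics (n - s))] by rewrite size_map.
  rewrite sum_nat_pred -size_filter.
  apply: uniq_leq_size; first by rewrite map_inj_uniq ?fset_uniq //; exact: mulIf.
  move=> _ /mapP [h + ->]; rewrite mem_monics => /asboolP Hh.
  rewrite mem_filter mem_powerfuls; apply/andP; split; apply/asboolP; first by exists h.
  split; last exact: monic_deg1_powerful.
  by have := monic_degM Hh (monic_degX s Hl); rewrite muln1 subnK.
(* A common multiple of [l ^+ s] and [l' ^+ s] is a multiple of their product, with a monic cofactor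
   of degree [n - 2 * s]. *)
have ub l l' : l \in L -> l' \in L -> l' != l ->
    (\sum_(f <- Q) d l f * d l' f <= num_monic F r (n - 2 * s))%N.
  rewrite !memL => /asboolP Hl /asboolP Hl' ne.
  under eq_bigr do rewrite mulnb.
  rewrite (sum_nat_pred _ (fun f => d l f && d l' f)) -size_filter.
  have -> : num_monic F r (n - 2 * s) = size [seq h * (l ^+ s * l' ^+ s)
      | h <- enum_fset (monics (n - 2 * s))] by rewrite size_map.
  apply: uniq_leq_size; first by rewrite filter_uniq // fset_uniq.
  move=> f; rewrite mem_filter mem_powerfuls => /andP[/andP[/asboolP dl /asboolP dl']].
  move=> /asboolP [Hf _].
  rewrite eq_sym in ne; have [h Eh] := monic_deg1_coprime Hl Hl' ne dl dl'.
  apply/mapP; exists h => //; rewrite mem_monics; apply/asboolP.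
  have Hll := monic_degM (monic_degX s Hl) (monic_degX s Hl').
  move: Hf; rewrite Eh; case/(monic_deg_divl Hll) => _.
  by rewrite !muln1 addnn -mul2n.
have -> : (num_monic F r 1 * num_monic F r (n - s) =
    \sum_(l <- L) num_monic F r (n - s))%N.
  by rewrite big_const_seq count_predT iter_addn_0 mulnC.
apply: (@leq_trans (\sum_(l <- L) \sum_(f <- Q) d l f)).
  by rewrite !big_seq; apply: leq_sum.
rewrite exchange_big /=.
apply: (@leq_trans (\sum_(f <- Q)
    (1 + \sum_(l <- L) \sum_(l' <- L | l' != l) d l f * d l' f))).
  by apply: leq_sum => f _; apply: sum_le_1_pairs; exact: fset_uniq.
rewrite big_split /= sum1_size leq_add2l exchange_big /=.
under eq_bigr do rewrite exchange_big /=.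
apply: (@leq_trans (\sum_(l <- L) \sum_(l' <- L) num_monic F r (n - 2 * s))).
  rewrite !big_seq; apply: leq_sum => l lL; rewrite big_mkcond /=.
  rewrite [leqLHS]big_seq; apply: leq_sum => l' l'L.
  by case: (boolP (l' != l)) => //= ne; apply: ub.
by rewrite !big_const_seq !count_predT !iter_addn_0 -mulnA mulnC.
Qed.

End Bounds.

(** * Growth and convexity of the binomial exponents *)

Section BinomialGrowth.

Variable r : nat.
Hypothesis r2 : (2 <= r)%N.

(** [A k] counts the monomials of degree at most [k] in [r] variables, and [D k] those of degree
    exactly [k]. *)
Local Notation A k := 'C(r + k, r).
Local Notation D k := 'C(r + k - 1, r - 1).

Lemma bin_shift0 : A 0 = 1%N. Proof. by rewrite addn0 binn. Qed.

Lemma bin_shift1 : A 1 = r.+1. Proof. by rewrite addn1 binSn. Qed.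

Lemma bin_shift2 : (2 * A 2 = (r + 2) * (r + 1))%N.
Proof.
have := bin_ffact (r + 2) 2; rewrite -(@bin_sub (r + 2) r) ?leq_addr // addKn.
by rewrite !ffactnS ffactn0 /= !factS fact0; move=> E; nia.
Qed.

Lemma bin_shift3 : (6 * A 3 = (r + 3) * (r + 2) * (r + 1))%N.
Proof.
have := bin_ffact (r + 3) 3; rewrite -(@bin_sub (r + 3) r) ?leq_addr // addKn.
by rewrite !ffactnS ffactn0 /= !factS fact0; move=> E; nia.
Qed.

Lemma bin_shift4 : (24 * A 4 = (r + 4) * (r + 3) * (r + 2) * (r + 1))%N.
Proof.
have := bin_ffact (r + 4) 4; rewrite -(@bin_sub (r + 4) r) ?leq_addr // addKn.
by rewrite !ffactnS ffactn0 /= !factS fact0; move=> E; nia.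
Qed.

Lemma bin_shiftS k : A k.+1 = (A k + D k.+1)%N.
Proof. by case: r r2 => // r' _; rewrite addnS binS addSn !subn1. Qed.

Lemma bin_diff_mono i j : (i <= j)%N -> (D i <= D j)%N.
Proof. by move=> ij; apply: leq_bin2l; lia. Qed.

Lemma bin_diff1 : D 1 = r.
Proof. by case: r r2 => // r' _; rewrite addn1 !subn1 binSn. Qed.

Lemma bin_diff_gt0 k : (0 < D k)%N.
Proof. by rewrite bin_gt0; lia. Qed.

Lemma bin_shift_growth k i : (A k + i <= A (k + i))%N.
Proof.
elim: i => [|i IH]; first by rewrite !addn0.
by rewrite addnS [(k + i.+1)%N]addnS bin_shiftS; have := bin_diff_gt0 (k + i).+1; lia.
Qed.

(** Convexity: the increments [D] are nondecreasing, so [t] steps from [j] gain at least as much as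
    [t] steps from [i]. *)
Lemma bin_shift_exchange i j t : (i <= j)%N -> (A j + A (i + t) <= A i + A (j + t))%N.
Proof.
move=> ij; elim: t => [|t IH]; first by rewrite !addn0 addnC.
rewrite ![(_ + t.+1)%N]addnS !bin_shiftS.
by have := @bin_diff_mono (i + t).+1 (j + t).+1; lia.
Qed.

Lemma bin_shift_decay n s k : (2 <= s)%N -> (3 * s <= n)%N ->
  ~ (n = 6%N /\ s = 2%N) -> (2 <= k)%N -> (s * k <= n)%N ->
  (A k + A (n - s * k) + (k - 2) <= A 2 + A (n - 2 * s))%N.
Proof.
move=> s2 n3 ns; case: k => [|[|t]] // _ skn; rewrite subSS subSS subn0.
have -> : (n - 2 * s = (n - s * t.+2) + s * t)%N by nia.
have st : (2 * t <= s * t)%N by rewrite leq_mul2r s2 orbT.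
have [->|t0] := posnP t; first by rewrite muln0 !addn0.
set j := (n - s * t.+2)%N.
have A2 := bin_shift2; have A1 := bin_shift1.
(* For [j >= 2], convexity trades [A t.+2] against [A (j + t)], and the remaining [s * t - t >= t]
   steps pay for the decay [k - 2]. For [j < 2], growth from [A t.+2] to [A (j + s * t)] is
   enough. *)
have [j2|] := leqP 2 j.
  have := bin_shift_exchange t j2.
  have := bin_shift_growth (j + t) (s * t - t).
  have -> : (j + t + (s * t - t) = j + s * t)%N by lia.
  by rewrite add2n; lia.
have st1 : (t.+1 <= s * t)%N by lia.
case Ej: j => [|[|j']] // _.
  (* With [j = 0] this fails only for [t = 1] and [s = 2], which is the excluded case [n = 6]. *)
  have st2 : (t.+2 <= s * t)%N.
    have [//|lt] := leqP t.+2 (s * t)%N.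
    case: ns; have t1 : t = 1%N by lia.
    by move: st lt Ej; rewrite /j t1; lia.
  have := bin_shift_growth t.+2 (s * t - t.+2); rewrite subnKC // add0n addn0 binn.
  by nia.
have := bin_shift_growth t.+2 (s * t - t.+1).
have -> : (t.+2 + (s * t - t.+1) = 1 + s * t)%N by lia.
by rewrite A1; nia.
Qed.

(** For [(n, s) = (6, 2)] the term [k = 3] exceeds the term [k = 2] by the cubic exponent minus one;
    that spare unit later yields a factor [q^-1]. *)
Lemma cubic_exponent :
  (A 3 + A 0 + 1 = A 2 + A 2 + (((r - 2) * (r - 1) * (r + 3)) %/ 6))%N.
Proof.
have A2 := bin_shift2; have A3 := bin_shift3; rewrite bin_shift0.
have -> : ((r - 2) * (r - 1) * (r + 3) = (A 3 + 2 - 2 * A 2) * 6)%N.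
  move: A2 A3; move: r2; case: r => [|[|a]] // _.
  by move: ('C(_, _)) ('C(_, _)) => x y; nia.
rewrite mulnK //.
move: A2 A3; move: r2; case: r => [|[|a]] // _.
by move: ('C(_, _)) ('C(_, _)) => x y; nia.
Qed.

End BinomialGrowth.

(** * Rational estimates for the main and error terms *)

Section Estimates.

Variables (F : finFieldType) (r : nat).
Hypothesis r2 : (2 <= r)%N.

Local Notation A k := 'C(r + k, r).
Local Notation D k := 'C(r + k - 1, r - 1).
Local Notation x := (#|F|%:R : rat).
Local Notation d k := (1 - x ^- D k).
Local Notation P k := ((num_monic F r k)%:R : rat).

Lemma card_ge2 : 2 <= x.
Proof. by rewrite (ler_nat _ 2); exact: card_finNzRing_gt1. Qed.

Let x_gt0 : 0 < x. Proof. by apply: lt_le_trans card_ge2. Qed.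
Let x_neq0 : x != 0. Proof. by rewrite gt_eqF. Qed.
Let x1_neq0 : x - 1 != 0. Proof. by have := card_ge2; lra. Qed.
Let x_ge1 : 1 <= x. Proof. by apply: le_trans card_ge2. Qed.

Lemma card_inv_le : x^-1 <= 2^-1.
Proof. by rewrite lef_pV2 ?posrE ?card_ge2. Qed.

Let u_gt0 : 0 < x^-1. Proof. by rewrite invr_gt0. Qed.
Let v_gt0 : 0 < 1 - x^-1. Proof. by have := card_inv_le; lra. Qed.

Lemma num_monicE n : P n = x ^+ (A n - 1) * (d n / (1 - x^-1)).
Proof.
have r0 : (0 < r)%N by lia.
(* Monomials of degree at most [n] are split at degree [n]. The case [n = 0] is separate: no
   monomial has degree below [0], and [D 0 = 1]. *)
have EN : A n = (#|{: 'X_{1..r < n}}| + D n)%N.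
  case: n => [|n]; last by rewrite card_bmultinom bin_shiftS.
  by rewrite bin_shift0 addn0 binn eq_card0 // => -[].
have := congr1 (fun k : nat => k%:R : rat) (num_monic_recr F r n).
rewrite natrD natrM !natrX card_bmultinom EN exprD.
rewrite -subn1 natrB; last exact: ltnW (card_finNzRing_gt1 F).
have D0 := bin_diff_gt0 r2 n.
set N := #|{: 'X_{1..r < n}}|; rewrite -(addnBA N D0) => E.
have E1 : x ^+ D n = x ^+ (D n - 1) * x.
  by case: (D n) D0 => // c _; rewrite subn1 exprSr.
have y0 : x ^+ (D n - 1) != 0 by rewrite expf_neq0.
apply: (mulfI x1_neq0); rewrite -[LHS](addrK (x ^+ N)) E exprD E1.
by field; rewrite x_neq0 x1_neq0 y0.
Qed.

Lemma d_le1 n : d n <= 1.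
Proof. by rewrite gerBl invr_ge0 exprn_ge0 // ltW. Qed.

Lemma d_mono i j : (i <= j)%N -> d i <= d j.
Proof.
move=> ij; rewrite lerD2l lerN2 lef_pV2 ?posrE ?exprn_gt0 //.
by apply: ler_weXn2l => //; apply: bin_diff_mono.
Qed.

Lemma d_gt0 n : 0 < d n.
Proof.
apply: lt_le_trans (d_mono (leq0n n)).
by rewrite addn0 binn expr1.
Qed.

(** Here [q ^ r >= 4]; this is the source of the constant [4 / 3] below. *)
Lemma d1_ge : 3 / 4 <= d 1.
Proof.
rewrite bin_diff1 //.
have : x ^- r <= 4^-1.
  rewrite lef_pV2 ?posrE ?exprn_gt0 //.
  apply: le_trans (ler_weXn2l x_ge1 r2).
  by have := card_ge2; nra.
lra.
Qed.

Section FixedDegrees.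

Variables (s n : nat).
Hypothesis sn : (2 * s <= n)%N.

(* Equal to [eta * q ^ (- delta)], see [eta_tail_scale]. *)
Definition tail_scale : rat :=
  x ^+ (A 2 + A (n - 2 * s) - 2) * (d 1 * d (n - s) / (1 - x^-1) ^+ 2).

Lemma tail_scale_ge0 : 0 <= tail_scale.
Proof.
apply: mulr_ge0; first by rewrite exprn_ge0 // ltW.
by rewrite divr_ge0 ?exprn_ge0 ?mulr_ge0 // ltW // d_gt0.
Qed.

Let A_gt0 k : (0 < A k)%N. Proof. by rewrite bin_gt0 leq_addr. Qed.

Lemma etaE : eta r n s #|F| = P 1 * P (n - s).
Proof.
rewrite !num_monicE /eta bin_shift1 bin_diff1 //.
have -> : (r + n - s = r + (n - s))%N by lia.
have -> : (A (n - s) + r - 1 = (r.+1 - 1) + (A (n - s) - 1))%N.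
  by have := A_gt0 (n - s); lia.
by rewrite exprD; field; rewrite ?x_neq0 ?x1_neq0 ?expf_neq0.
Qed.

Lemma eta_tail_scale : eta r n s #|F| * x ^ (- delta r n s) = tail_scale.
Proof.
rewrite etaE !num_monicE /tail_scale bin_shift1.
have -> : x ^ (- delta r n s) = x ^+ (A 2 + A (n - 2 * s) - 2)
    / (x ^+ (r.+1 - 1) * x ^+ (A (n - s) - 1)).
  apply: canRL (mulfK _) _; first by rewrite mulf_neq0 ?expf_neq0.
  rewrite -exprD !exprnP -expfzDr //; congr (x ^ _).
  rewrite /delta.
  have -> : (r + n - s = r + (n - s))%N by lia.
  have -> : (r + n - 2 * s = r + (n - 2 * s))%N by lia.
  (* This turns the last term of [delta] into the exponents [A 2] and [A 1 = r.+1]. *)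
  have -> : ((r * (r + 1)) %/ 2 = A 2 - r.+1)%N.
    have -> : (r * (r + 1) = (A 2 - r.+1) * 2)%N by have := bin_shift2 r2; nia.
    by rewrite mulnK.
  have := A_gt0 (n - s); have := A_gt0 (n - 2 * s); have := bin_shift2 r2.
  by nia.
by field; rewrite ?x_neq0 ?x1_neq0 ?expf_neq0.
Qed.

(** Here [t] is the decay gained over the term [k = 2] and [e] an allowed excess. The powers of [q]
    compare by hypothesis; for the bounded factors, [d k <= 1 <= 4 / 3 * d 1] and [d] is
    monotone. *)
Lemma num_monicM_le k t e :
  (s * k <= n)%N -> (0 < k)%N ->
  (A k + A (n - s * k) + t <= A 2 + A (n - 2 * s) + e)%N ->
  P k * P (n - s * k) <= 4 / 3 * tail_scale * x ^+ e * x^-1 ^+ t.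
Proof.
move=> skn k0 le; rewrite !num_monicE /tail_scale.
set a := (A (n - s * k))%N; set b := A (n - 2 * s).
have a0 : (0 < a)%N by exact: A_gt0.
have b0 : (0 < b)%N by exact: A_gt0.
have k1 := A_gt0 k; have A20 := A_gt0 2.
have Hexp : x ^+ (A k - 1) * x ^+ (a - 1) <= x ^+ (A 2 + b - 2) * x ^+ e * x^-1 ^+ t.
  rewrite exprVn ler_pdivlMr ?exprn_gt0 // -!exprD.
  by apply: ler_weXn2l => //; rewrite /a /b; lia.
have Hd : d k * d (n - s * k) <= 4 / 3 * (d 1 * d (n - s)).
  rewrite mulrA; apply: ler_pM; rewrite ?(ltW (d_gt0 _)) //.
    by have := d_le1 k; have := d1_ge; lra.
  by apply: d_mono; rewrite leq_sub2l // -[leqLHS]muln1 leq_mul2l k0 orbT.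
have -> : x ^+ (A k - 1) * (d k / (1 - x^-1))
    * (x ^+ (a - 1) * (d (n - s * k) / (1 - x^-1)))
  = (x ^+ (A k - 1) * x ^+ (a - 1)) * (d k * d (n - s * k)) / (1 - x^-1) ^+ 2.
  by field; rewrite ?x_neq0 ?x1_neq0 ?expf_neq0.
have -> : 4 / 3 * (x ^+ (A 2 + b - 2) * (d 1 * d (n - s) / (1 - x^-1) ^+ 2))
    * x ^+ e * x^-1 ^+ t
  = (x ^+ (A 2 + b - 2) * x ^+ e * x^-1 ^+ t)
    * (4 / 3 * (d 1 * d (n - s))) / (1 - x^-1) ^+ 2.
  by rewrite !exprVn; field; rewrite ?x_neq0 ?x1_neq0 ?expf_neq0.
rewrite ler_pM2r ?invr_gt0 ?exprn_gt0 //.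
by apply: ler_pM => //; rewrite mulr_ge0 ?exprn_ge0 ?(ltW x_gt0) ?(ltW (d_gt0 _)).
Qed.

Lemma num_powerful_lower :
  eta r n s #|F| - (num_powerful F r n s)%:R <= 2 * tail_scale.
Proof.
have := num_powerful_ge F r sn.
rewrite -(ler_nat rat) natrD !natrM -etaE => H.
suff : P 1 * P 1 * P (n - 2 * s) <= 2 * tail_scale by lra.
rewrite !num_monicE /tail_scale bin_shift1.
set b := A (n - 2 * s); have b0 : (0 < b)%N by exact: A_gt0.
(* This amounts to [2 * r + 1 <= A 2], true for [r >= 2]. *)
have Hexp : x ^+ (r.+1 - 1) * x ^+ (r.+1 - 1) * x ^+ (b - 1) <= x ^+ (A 2 + b - 2).
  rewrite -!exprD; apply: ler_weXn2l => //.
  by have := bin_shift2 r2; nia.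
have Hd : d 1 * d (n - 2 * s) <= d (n - s).
  rewrite -[leRHS]mul1r; apply: ler_pM; rewrite ?(ltW (d_gt0 _)) ?d_le1 //.
  by apply: d_mono; lia.
(* The product of three counts has one more factor [(1 - x^-1)^-1] than [tail_scale]; it costs the
   constant [2]. *)
have Hv : (1 - x^-1)^-1 <= 2.
  by rewrite -[leRHS]invrK lef_pV2 ?posrE //; have := card_inv_le; lra.
set v := 1 - x^-1 in Hv *.
have v0 : v != 0 by rewrite gt_eqF.
set X := x ^+ (r.+1 - 1) in Hexp *; set Y := x ^+ (b - 1) in Hexp *.
set Z := x ^+ (A 2 + b - 2) in Hexp *.
have -> : X * (d 1 / v) * (X * (d 1 / v)) * (Y * (d (n - 2 * s) / v)) =
  (X * X * Y) * (v^-1 * (d 1 * (d 1 * d (n - 2 * s)))) / v ^+ 2.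
  by field; rewrite ?x_neq0 ?v0 ?expf_neq0.
have -> : 2 * (Z * (d 1 * d (n - s) / v ^+ 2)) = Z * (2 * (d 1 * d (n - s))) / v ^+ 2.
  by field; rewrite ?x_neq0 ?v0 ?expf_neq0.
rewrite ler_pM2r ?invr_gt0 ?exprn_gt0 //.
have d0 k := ltW (d_gt0 k).
have X0 : 0 <= X by rewrite exprn_ge0 // ltW.
have Y0 : 0 <= Y by rewrite exprn_ge0 // ltW.
apply: ler_pM; rewrite ?mulr_ge0 ?invr_ge0 ?(ltW v_gt0) ?d0 //.
by apply: ler_pM; rewrite ?mulr_ge0 ?invr_ge0 ?(ltW v_gt0) ?d0 // ler_pM2l ?d_gt0.
Qed.

Lemma num_powerful_upper : (0 < s)%N ->
  (num_powerful F r n s)%:R - eta r n s #|F|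
    <= \sum_(2 <= k < (n %/ s).+1) P k * P (n - s * k).
Proof.
move=> s0; have := num_powerful_le F r n s0; rewrite -(ler_nat rat) => H.
have K2 : (2 <= n %/ s)%N by rewrite leq_divRL.
rewrite etaE lerBlDl; apply: le_trans H _.
rewrite big_ltn ?ltnS ?(ltnW K2) // natrD natrM muln1 lerD2l natr_sum.
by apply: ler_sum => k _; rewrite natrM.
Qed.

End FixedDegrees.

Lemma geometric_sum_le2 m : \sum_(k < m) x^-1 ^+ k <= 2.
Proof.
(* The subtracted remainder makes the induction go through, using [x^-1 <= 1 / 2]. *)
have H : \sum_(k < m) x^-1 ^+ k <= 2 - x^-1 ^+ m * 2.
  elim: m => [|m IH]; first by rewrite big_ord0 expr0 mul1r subrr.
  rewrite big_ord_recr /= exprS.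
  have := exprn_ge0 m (ltW u_gt0); have := card_inv_le; nra.
by apply: le_trans H _; rewrite gerBl mulr_ge0 // exprn_ge0 // ltW.
Qed.

End Estimates.

(** * The exceptional case and the final bounds *)

Lemma delta_6_2 (r : nat) : (2 <= r)%N ->
  (delta r 6 2)%:~R =
    r%:R * (r%:R + 1) * (r%:R ^+ 2 + 9 * r%:R + 2) / 24 :> rat.
Proof.
move=> r2; rewrite /delta.
have -> : (r + 6 - 2 = r + 4)%N by lia.
have -> : (r + 6 - 2 * 2 = r + 2)%N by lia.
have half : (2 * ((r * (r + 1)) %/ 2) = r * (r + 1))%N.
  have E := bin_shift2 r2.
  have -> : (r * (r + 1) = ('C(r + 2, r) - r.+1) * 2)%N by nia.
  by rewrite mulnK // mulnC.
move: (bin_shift4 r2) (bin_shift2 r2) half => /(congr1 (fun k : nat => k%:R : rat)) E4.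
move=> /(congr1 (fun k : nat => k%:R : rat)) E2.
move=> /(congr1 (fun k : nat => k%:R : rat)) E1.
move: E4 E2 E1; rewrite !natrM !natrD !rmorphB /= !pmulrn => E4 E2 E1.
lra.
Qed.

(* In the first part the division by 6 of natural numbers is exact. *)
Theorem theorem5p4 (r s n q : nat) (F : finFieldType)
    (hr : (2 <= r)%N) (hs : (2 <= s)%N) (hq : #|F| = q) :
  (n = 6%N /\ s = 2%N ->
     (delta r n s)%:~R =
       r%:R * (r%:R + 1) * (r%:R ^+ 2 + 9 * r%:R + 2) / 24 :> rat
     /\
     `|(num_powerful F r n s)%:R - eta r n s q|
       <= eta r n s q *
          (2 * q%:R ^ (- delta r n s
                       + (((r - 2) * (r - 1) * (r + 3)) %/ 6)%N%:Z)))
  /\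
  ((3 * s <= n)%N -> ~ (n = 6%N /\ s = 2%N) ->
     `|(num_powerful F r n s)%:R - eta r n s q|
       <= eta r n s q * (6 * q%:R ^ (- delta r n s))).
Proof.
subst q.
split.
  case=> -> ->; split; first exact: delta_6_2.
  have sn : (2 * 2 <= 6)%N by [].
  set e := (_ %/ 6)%N.
  have x2 := card_ge2 F; set x := #|F|%:R in x2 *.
  have x0 : 0 < x by lra.
  have xe1 : 1 <= x ^+ e by rewrite exprn_ege1 //; lra.
  have -> : eta r 6 2 #|F| * (2 * x ^ (- delta r 6 2 + e%:Z))
      = 2 * tail_scale F r 2 6 * x ^+ e.
    by rewrite expfzDr ?gt_eqF // -(eta_tail_scale F hr sn) exprnP; ring.
  have T := tail_scale_ge0 F hr 2 6; set t := tail_scale F r 2 6 in T *.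
  have low := num_powerful_lower F hr sn; rewrite -/t in low.
  have up := num_powerful_upper F hr sn isT.
  have te : t <= t * x ^+ e by rewrite ler_peMr.
  rewrite ler_norml; apply/andP; split; first lra.
  apply: le_trans up _; rewrite (_ : (6 %/ 2).+1 = 4)%N //.
  rewrite big_ltn // big_nat1.
  (* Only [k = 2] and [k = 3] occur. They contribute at most [4 / 3 * t] and
     [4 / 3 * t * x ^+ e * x^-1]; with [x^-1 <= 1 / 2] and [1 <= x ^+ e] the total is at most
     [2 * t * x ^+ e]. *)
  have H2 := @num_monicM_le F r hr 2 6 sn 2 0 0 isT isT (leqnn _).
  have H3 := @num_monicM_le F r hr 2 6 sn 3 1 e isT isT.
  have {}H3 := H3 (eq_leq (cubic_exponent hr)).
  rewrite !expr0 !mulr1 -/t in H2; rewrite expr1 -/t -/x in H3.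
  have u2 : 4 / 3 * t * x ^+ e * x^-1 <= 4 / 3 * t * x ^+ e * 2^-1.
    by apply: ler_wpM2l; [apply: mulr_ge0; lra | exact: card_inv_le].
  lra.
move=> n3 ns; have sn : (2 * s <= n)%N by lia.
have -> : eta r n s #|F| * (6 * #|F|%:R ^ (- delta r n s)) = 6 * tail_scale F r s n.
  by rewrite -(eta_tail_scale F hr sn); ring.
have T := tail_scale_ge0 F hr s n; set t := tail_scale F r s n in T *.
have low := num_powerful_lower F hr sn; rewrite -/t in low.
have s0 : (0 < s)%N by lia.
have up := num_powerful_upper F hr sn s0.
rewrite ler_norml; apply/andP; split; first lra.
apply: le_trans up _.
(* The geometric series sums to at most [2], so the upper error is at most [8 / 3 * t], within
   [6 * t]. *)
apply: (@le_trans _ _ (\sum_(2 <= k < (n %/ s).+1)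
  4 / 3 * t * (#|F|%:R)^-1 ^+ (k - 2))).
  rewrite !big_nat; apply: ler_sum => k /andP[k2 kn].
  have sk : (s * k <= n)%N by rewrite mulnC -leq_divRL.
  have := @num_monicM_le F r hr s n sn k (k - 2) 0 sk (ltnW k2).
  by rewrite addn0 expr0 mulr1; apply; apply: bin_shift_decay.
rewrite -mulr_sumr (big_addn 0 _ 2).
under eq_bigr do rewrite addnK.
rewrite big_mkord.
by have := geometric_sum_le2 F ((n %/ s).+1 - 2); nra.
Qed.
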